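(* Let $\Omega=(-1,1)$ and let $\mathbf{D}=-W'$ with $W:\mathbb{R}\to[0,\infty)$ smooth, strictly convex, even, with a unique global minimum at $0$. Let $g=g(t,\omega,m)\ge0$ be a (sufficiently regular) solution, symmetric in $(\omega,m)$, of $$\partial_t g(\omega,m)+\partial_\omega\big(a[g](\omega)g(\omega,m)\big)+\partial_m\big(a[g](m)g(\omega,m)\big)=0,\qquad(\omega,m)\in\Omega^2,$$ with zero-flux boundary conditions $a[g](\omega)g(\omega,m)=0$ for $\omega\in\partial\Omega$, $m\in\Omega$ (and symmetrically $a[g](m)g(\omega,m)=0$ for $m\in\partial\Omega$, $\omega\in\Omega$). Then for all $t\ge0$ $$\int_\Omega\int_\Omega\omega\,g(t,\omega,m)\,d\omega\,dm=\int_\Omega\int_\Omega\omega\,g(0,\omega,m)\,d\omega\,dm.$$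
   Context: For a nonnegative function $g=g(\omega,m)$ on $\Omega^2$, $$a[g](\omega)=\int_\Omega\eta[g](\omega,m)\,\mathbf{D}(\omega-m)\,dm,\qquad \eta[g](\omega,m)=\frac{g(\omega,m)}{\int_\Omega g(\omega,m')\,dm'},$$ with $\eta[g](\omega,\cdot)=0$ if $g(\omega,\cdot)=0$ a.e. In the equation, $a[g]$ is computed from $g(t,\cdot,\cdot)$ at each time $t$, and the time argument is omitted. ''Sufficiently regular'' means that $g$ is $C^1$ on $[0,\infty)\times\overline\Omega^2$, that the flux $(t,\omega,m)\mapsto a[g](\omega)g(\omega,m)$ is continuous on $[0,\infty)\times\overline\Omega^2$ and $C^1$ in $\omega$ there, and that the equation holds pointwise, so that differentiation under the integral and integration by parts are justified. $g$ represents the distribution of edges between opinions. *)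

(* Defs.v *)
From mathcomp Require Import all_boot all_order all_algebra.
From mathcomp Require Import all_classical all_reals all_analysis.
Set Implicit Arguments.
Unset Strict Implicit.
Unset Printing Implicit Defensive.
Import Order.TTheory GRing.Theory Num.Theory.
Import numFieldNormedType.Exports.
Local Open Scope classical_set_scope.
Local Open Scope ring_scope.

Definition Omega {R : realType} : set R := `]-1, 1[%classic.

Definition clOmega {R : realType} : set R := `[-1, 1]%classic.

Definition smooth {R : realType} (W : R -> R) : Prop :=
  forall (n : nat) (x : R), derivable (derive1n n W) x 1.

Definition strictly_convex {R : realType} (W : R -> R) : Prop :=
  forall x y s : R, x != y -> 0 < s -> s < 1 ->
    W (s * x + (1 - s) * y) < s * W x + (1 - s) * W y.

Definition eta {R : realType} (g : R -> R -> R) (w m : R) : R :=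
  if `[< g w = cst 0 %[ae (@lebesgue_measure R) in Omega] >] then 0
  else g w m / \int[@lebesgue_measure R]_(m' in Omega) g w m'.

Definition velocity {R : realType} (D : R -> R) (g : R -> R -> R) (w : R) : R :=
  \int[@lebesgue_measure R]_(m in Omega) (eta g w m * D (w - m)).

(* Functions of (t, w, m) are total; only their values on
   [0, +oo[ x clOmega x clOmega are ever constrained. *)
Definition flux {R : realType} (D : R -> R) (g : R -> R -> R -> R)
    (t w m : R) : R :=
  velocity D (g t) w * g t w m.

Definition cylinder {R : realType} : set (R * R * R) :=
  (`[0, +oo[%classic `*` clOmega) `*` clOmega.

Definition continuous_cyl {R : realType} (f : R -> R -> R -> R) : Prop :=
  {within @cylinder R, continuous (fun p : R * R * R => f p.1.1 p.1.2 p.2)}.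

(* C^1 up to the boundary in one variable: the two-sided derivative exists
   wherever that variable is interior to its range, and it extends to a
   function continuous on the whole cylinder (whose boundary values are then
   the one-sided derivatives when f itself is continuous there). *)
Definition C1_in_t {R : realType} (f : R -> R -> R -> R) : Prop :=
  exists2 f' : R -> R -> R -> R, continuous_cyl f' &
    forall t w m : R, 0 < t -> clOmega w -> clOmega m ->
      is_derive t 1 (fun s : R => f s w m) (f' t w m).

Definition C1_in_w {R : realType} (f : R -> R -> R -> R) : Prop :=
  exists2 f' : R -> R -> R -> R, continuous_cyl f' &
    forall t w m : R, 0 <= t -> Omega w -> clOmega m ->
      is_derive w 1 (fun x : R => f t x m) (f' t w m).

Definition C1_in_m {R : realType} (f : R -> R -> R -> R) : Prop :=
  exists2 f' : R -> R -> R -> R, continuous_cyl f' &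
    forall t w m : R, 0 <= t -> clOmega w -> Omega m ->
      is_derive m 1 (fun x : R => f t w x) (f' t w m).

Definition C1_cyl {R : realType} (f : R -> R -> R -> R) : Prop :=
  [/\ continuous_cyl f, C1_in_t f, C1_in_w f & C1_in_m f].

Definition sufficiently_regular {R : realType} (D : R -> R)
    (g : R -> R -> R -> R) : Prop :=
  [/\ C1_cyl g, continuous_cyl (flux D g) & C1_in_w (flux D g)].

(* The total derivatives below are genuine ones for a sufficiently regular g
   that is symmetric in (w, m).  The equation at t = 0, with the one-sided time
   derivative, follows by continuity. *)
Definition solves_equation {R : realType} (D : R -> R)
    (g : R -> R -> R -> R) : Prop :=
  forall t w m : R, 0 < t -> Omega w -> Omega m ->
    derive1 (fun s : R => g s w m) t
    + derive1 (fun x : R => velocity D (g t) x * g t x m) w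
    + derive1 (fun x : R => velocity D (g t) x * g t w x) m = 0.

Definition zero_flux {R : realType} (D : R -> R)
    (g : R -> R -> R -> R) : Prop :=
  forall t b x : R, 0 <= t -> (b = -1 \/ b = 1) -> Omega x ->
    velocity D (g t) b * g t b x = 0 /\ velocity D (g t) b * g t x b = 0.

(* Main.v *)
Require Import Defs.
From mathcomp Require Import all_boot all_order all_algebra.
From mathcomp Require Import all_classical all_reals all_analysis.
From mathcomp Require Import measurable_realfun.
Set Implicit Arguments.
Unset Strict Implicit.
Unset Printing Implicit Defensive.
Import Order.TTheory GRing.Theory Num.Theory.
Import numFieldNormedType.Exports.
Local Open Scope classical_set_scope.
Local Open Scope ring_scope.

(* Extending g, the flux and its w-derivative continuously to the whole space
   by clamping the arguments makes every integrand continuous, so that Fubini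
   and the fundamental theorem of calculus apply. Integrating the equation
   against w over time and space, the m-divergence term vanishes by the
   zero-flux condition, and the w-divergence term becomes minus the integral of
   the flux. Since a[g](w) * \int g(w, m) dm = \int g(w, m) D(w - m) dm, this is
   the double integral of g(w, m) D(w - m), which vanishes because g is
   symmetric and D is odd. *)

(** * Continuity and Borel measurability on product spaces *)

Section Continuity.
Context {T : topologicalType}.

Lemma continuous_pair {U V : topologicalType} (u : T -> U) (v : T -> V) :
  continuous u -> continuous v -> continuous (fun x => (u x, v x)).
Proof. by move=> cu cv x; apply: cvg_pair; [exact: cu|exact: cv]. Qed.

Lemma continuous_comp1 {U V : topologicalType} (f : U -> V) (u : T -> U) :
  continuous f -> continuous u -> continuous (fun x => f (u x)).
Proof.
by move=> cf cu x; apply: (@continuous_comp _ _ _ u f); [exact: cu|exact: cf].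
Qed.

Lemma continuous_comp2 {U V W : topologicalType} (f : U * V -> W)
    (u : T -> U) (v : T -> V) :
  continuous f -> continuous u -> continuous v ->
  continuous (fun x => f (u x, v x)).
Proof.
move=> cf cu cv x.
apply: (@continuous_comp _ _ _ (fun x => (u x, v x)) f); last exact: cf.
exact: continuous_pair.
Qed.

Lemma continuous_comp3 {U V V' W : topologicalType} (f : U * V * V' -> W)
    (u : T -> U) (v : T -> V) (v' : T -> V') :
  continuous f -> continuous u -> continuous v -> continuous v' ->
  continuous (fun x => f (u x, v x, v' x)).
Proof.
by move=> cf cu cv cv'; apply: continuous_comp2 => //; exact: continuous_pair.
Qed.

Lemma continuous_mul {R : realType} (u v : T -> R) :
  continuous u -> continuous v -> continuous (fun x => u x * v x).
Proof. by move=> cu cv x; apply: cvgM; [exact: cu|exact: cv]. Qed.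

Lemma continuous_add {R : realType} (u v : T -> R) :
  continuous u -> continuous v -> continuous (fun x => u x + v x).
Proof. by move=> cu cv x; apply: cvgD; [exact: cu|exact: cv]. Qed.

Lemma continuous_opp {R : realType} (u : T -> R) :
  continuous u -> continuous (fun x => - u x).
Proof. by move=> cu x; apply: cvgN; exact: cu. Qed.

Lemma continuous_maxr {R : realType} (u v : T -> R) :
  continuous u -> continuous v -> continuous (fun x => Num.max (u x) (v x)).
Proof. by move=> cu cv x; exact: (@continuous_max R T u v x (cu x) (cv x)). Qed.

Lemma continuous_minr {R : realType} (u v : T -> R) :
  continuous u -> continuous v -> continuous (fun x => Num.min (u x) (v x)).
Proof. by move=> cu cv x; exact: (@continuous_min R T u v x (cu x) (cv x)). Qed.

End Continuity.

Lemma continuous_fst {U V : topologicalType} : continuous (@fst U V).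
Proof. by move=> x; exact: cvg_fst. Qed.

Lemma continuous_snd {U V : topologicalType} : continuous (@snd U V).
Proof. by move=> x; exact: cvg_snd. Qed.

(** The plane is second countable: an open set is the union of the countably many products of balls
    with rational centres and radius 1/(n+1) that it contains, and such products are measurable
    rectangles. *)
Lemma open_measurable_prod {R : realType} (U : set (R * R)) :
  open U -> measurable U.
Proof.
move=> oU.
pose B (i : rat * rat * nat) : set (R * R) :=
  ball (ratr i.1.1 : R) i.2.+1%:R^-1 `*` ball (ratr i.1.2 : R) i.2.+1%:R^-1.
(* Boxes not contained in [U] are replaced by the empty set, so that the union runs over a whole
   countable type. *)
have -> : U = \bigcup_i (if `[< B i `<=` U >] then B i else set0).
  apply/seteqP; split => [[x y] Uxy|z [i _]]; last first.
    by case: asboolP => // BU /BU.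
  have /nbhs_ballP[e /= e0 eU] : nbhs (x, y) U by exact: open_nbhs_nbhs.
  have [n ne] : exists n, n.+1%:R^-1 < e / 2 :> R.
    have [n] : exists n, 0 + n.+1%:R^-1 < e / 2.
      by apply: ltr_add_invr; rewrite divr_gt0.
    by rewrite add0r => ne; exists n.
  have n0 : 0 < n.+1%:R^-1 :> R by rewrite invr_gt0.
  have [p] : exists p, ratr p \in `]x - n.+1%:R^-1, x + n.+1%:R^-1[.
    by apply: rat_in_itvoo; rewrite ltrD2l gtrN.
  have [q] : exists p, ratr p \in `]y - n.+1%:R^-1, y + n.+1%:R^-1[.
    by apply: rat_in_itvoo; rewrite ltrD2l gtrN.
  rewrite !in_itv /= -!ltr_distl => qy px.
  exists (p, q, n) => //.
  case: asboolP => [_|[]]; first by split.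
  (* Both [x] and [x'] lie within e/2 of the rational centre, hence within e of each other; likewise
     for [y] and [y']. *)
  move=> [x' y'] [/= bx by_]; apply: eU; split => /=.
    apply: (@ball_splitr R R (ratr p : R)).
      exact: (@le_ball R R _ _ _ (ltW ne) _ px).
    exact: (@le_ball R R _ _ _ (ltW ne) _ bx).
  apply: (@ball_splitr R R (ratr q : R)).
    exact: (@le_ball R R _ _ _ (ltW ne) _ qy).
  exact: (@le_ball R R _ _ _ (ltW ne) _ by_).
apply: countable_bigcupT_measurable => [|i]; first exact: countableP.
by case: ifP => // _; apply: measurableX; exact: measurable_ball.
Qed.

Lemma continuous_measurable_fun_prod {R : realType} (f : R * R -> R) :
  continuous f -> measurable_fun setT f.
Proof.
move=> /continuousP cf.
apply: (measurability _ (RGenOpens.measurableE R)).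
move=> _ [_ [a [b ->] <-]]; rewrite setTI.
apply: open_measurable_prod; apply: cf; exact: interval_open.
Qed.

(** * Integrals of continuous functions over bounded open intervals and rectangles *)

Section IntegralOfContinuous.
Context {R : realType}.
Notation mu := (@lebesgue_measure R).
Implicit Types (f F : R -> R) (a b c d : R).

Lemma continuous_integrable_itvcc f a b :
  continuous f -> mu.-integrable `[a, b] (EFin \o f).
Proof.
move=> cf; apply: continuous_compact_integrable; first exact: segment_compact.
exact: continuous_subspaceT.
Qed.

Lemma continuous_integrable_itvoo f a b :
  continuous f -> mu.-integrable `]a, b[ (EFin \o f).
Proof.
move=> cf; apply: (@integrableS _ _ R mu `[a, b]%classic) => //.
  by apply: subset_itvW.
exact: continuous_integrable_itvcc.
Qed.

(** The endpoints form a null set, so the theorem on the closed interval transfers. The derivative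
    is required only at interior points, where the regularity assumptions provide a two-sided
    one. *)
Lemma Rintegral_itvoo_FTC2 f F a b : a < b ->
  continuous f -> continuous F ->
  (forall x, `]a, b[%classic x -> is_derive x 1 F (f x)) ->
  \int[mu]_(x in `]a, b[) f x = F b - F a.
Proof.
move=> ab cf cF dF.
have ftc : (\int[mu]_(x in `[a, b]) (f x)%:E = (F b)%:E - (F a)%:E)%E.
  apply: continuous_FTC2 => //; first exact: continuous_subspaceT.
    split=> [x xab||]; first by apply: ex_derive; exact: dF.
      exact/cvg_at_right_filter/cF.
    exact/cvg_at_left_filter/cF.
  by move=> x /dF ?; rewrite derive1E derive_val.
rewrite Rintegral_itv_obnd_cbnd; last exact: continuous_integrable_itvoo.
rewrite Rintegral_itv_bndo_bndc; first by rewrite /Rintegral ftc.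
apply: (@integrableS _ _ R mu `[a, b]%classic) => //.
  by apply: subset_itvl; rewrite bnd_simp.
exact: continuous_integrable_itvcc.
Qed.

(** Compactness of [a, b] makes the integrands uniformly close once the parameters are close, so no
    dominating function is required. Leaving [T] arbitrary allows one or several parameters. *)
Lemma continuous_Rintegral_itvoo {T : topologicalType} (f : T * R -> R) a b :
  continuous f -> continuous (fun p => \int[mu]_(x in `]a, b[) f (p, x)).
Proof.
move=> cf p0.
have cfp p : continuous (fun x => f (p, x)).
  apply: continuous_comp2 => //; first exact: cst_continuous.
  by move=> x; exact: cvg_id.
apply/cvgrPdist_le => e e0.
(* The added 1 keeps the denominator positive, and still d * (b - a) <= e. *)
pose d := e / (`|b - a| + 1).
have d0 : 0 < d by rewrite divr_gt0// ltr_wpDl.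
have : \forall p \near p0,
    `[a, b]%classic `<=` (fun x => `|f (p0, x) - f (p, x)| <= d).
  (* Tube argument: it suffices to find, for each [x], a neighbourhood of (x, p0) on which the bound
     holds. *)
  apply: ((compact_near_coveringP _).1 (@segment_compact R a b)) => x _.
  have cB : continuous (fun z : R * T => f (p0, z.1) - f (z.2, z.1)).
    apply: continuous_add; last apply: continuous_opp.
      apply: continuous_comp2 => //; first exact: cst_continuous.
      exact: continuous_fst.
    exact: continuous_comp2 cf continuous_snd continuous_fst.
  have /cvgrPdist_le/(_ _ d0) := cB (x, p0).
  by apply: filterS => -[x' p] /=; rewrite subrr sub0r normrN.
apply: filterS => p pd.
rewrite -RintegralB//; [|exact: continuous_integrable_itvoo..].
have cB : continuous (fun x => f (p0, x) - f (p, x)).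
  by apply: continuous_add => //; exact: continuous_opp.
apply: (le_trans (le_normr_Rintegral _ _)) => //.
  exact: continuous_integrable_itvoo.
apply: (@le_trans _ _ (\int[mu]_(x in `]a, b[) d)).
  apply: le_Rintegral => //.
  - apply: continuous_integrable_itvoo => x.
    by apply: cvg_norm; exact: cB.
  - exact/continuous_integrable_itvoo/cst_continuous.
  - by move=> x xab; apply: pd; exact: (subset_itvW _ _ (lexx a) (lexx b)) xab.
rewrite Rintegral_cst//= lebesgue_measure_itv /= lte_fin.
case: ifPn => ab; last by rewrite mulr0 ltW.
rewrite -EFinD /= /d mulrAC ler_pdivrMr ?ltr_wpDl//.
by rewrite ler_pM2l// (le_trans (ler_norm _))// lerDl.
Qed.

(** The function is bounded on the compact closed rectangle, and the open one has finite measure. *)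
Lemma continuous_integrable_rect (f : R * R -> R) a b c d : continuous f ->
  (mu \x mu)%E.-integrable (`]a, b[ `*` `]c, d[) (EFin \o f).
Proof.
move=> cf; apply: measurable_bounded_integrable.
- exact: measurableX.
- rewrite [ltLHS]product_measure1E//= !lebesgue_measure_itv /= !lte_fin.
  by do 2 case: ifP => _; rewrite ?mul0e ?mule0 ?ltry// -!EFinD -EFinM ltry.
- by apply: measurable_funTS; exact: continuous_measurable_fun_prod.
- have : compact (f @` (`[a, b] `*` `[c, d])).
    apply: continuous_compact; first exact: continuous_subspaceT.
    apply: compact_setX; first exact: (@segment_compact R a b).
    exact: (@segment_compact R c d).
  move=> /compact_bounded; rewrite /bounded_set /bounded_near.
  apply: filterS => M fM [x y] [/= xab ycd].
  apply: fM; exists (x, y) => //; split => /=.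
    exact: (subset_itvW _ _ (lexx a) (lexx b)) xab.
  exact: (subset_itvW _ _ (lexx c) (lexx d)) ycd.
Qed.

(** Extension by zero moves both domains into the integrand, giving an iterated integral over the
    whole plane to which [Fubini] applies. *)
Lemma Rintegral_itvoo_iterated (f : R * R -> R) a b c d : continuous f ->
  \int[mu]_(x in `]a, b[) \int[mu]_(y in `]c, d[) f (x, y) =
  fine (\int[mu]_x \int[mu]_y
    ((f \_ (`]a, b[ `*` `]c, d[)) (x, y))%:E).
Proof.
move=> cf; congr fine; rewrite integral_mkcond; apply: eq_integral => x _.
rewrite /= patchE; case: ifPn => xab.
  rewrite fineK; last first.
    apply: integrable_fin_num => //.
    apply: (continuous_integrable_itvoo (f := fun y => f (x, y))).
    apply: continuous_comp2 => //; first exact: cst_continuous.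
    by move=> y; exact: cvg_id.
  rewrite integral_mkcond; apply: eq_integral => y _.
  rewrite !patchE in_setX xab /=.
  by case: ifP.
rewrite integral0_eq// => y _.
by rewrite patchE in_setX (negbTE xab).
Qed.

Lemma Rintegral_itvoo_Fubini (f : R * R -> R) a b c d : continuous f ->
  \int[mu]_(x in `]a, b[) \int[mu]_(y in `]c, d[) f (x, y) =
  \int[mu]_(y in `]c, d[) \int[mu]_(x in `]a, b[) f (x, y).
Proof.
move=> cf; have cfs : continuous (fun z : R * R => f (z.2, z.1)).
  exact: continuous_comp2 cf continuous_snd continuous_fst.
rewrite Rintegral_itvoo_iterated// (Rintegral_itvoo_iterated c d a b cfs).
congr fine; rewrite (Fubini (m1 := mu) (m2 := mu)
  (f := EFin \o (f \_ (`]a, b[ `*` `]c, d[)))).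
  apply: eq_integral => y _; apply: eq_integral => x _ /=.
  by rewrite !patchE !in_setX andbC.
rewrite -restrict_EFin; apply: (integrable_mkcond _ _).1.
  exact: measurableX.
exact: continuous_integrable_rect.
Qed.

End IntegralOfContinuous.

(** * Continuous extension from the closed cylinder to the whole space *)

Lemma continuous_cyl_extension {R : realType} (f : R -> R -> R -> R) :
  continuous_cyl f ->
  exists2 F : R * R * R -> R, continuous F &
    forall t w m, 0 <= t -> clOmega w -> clOmega m -> F (t, w, m) = f t w m.
Proof.
move=> cf.
pose c (x : R) : R := Num.max (-1) (Num.min x 1).
have cc : continuous c.
  apply: continuous_maxr; first exact: cst_continuous.
  by apply: continuous_minr; [move=> x; exact: cvg_id|exact: cst_continuous].
have c_cl x : clOmega (c x).
  by rewrite /clOmega /c /= in_itv/= le_max lexx/= ge_max ge_min lexx orbT andbT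
    (le_trans (lerN10 _)).
have cE x : clOmega x -> c x = x.
  rewrite /clOmega /c /= in_itv/= => /andP[x1 x2].
  by rewrite (min_idPl _)// (max_idPr _).
(* [C] is a continuous retraction of the space onto the cylinder; the extension is [f] composed with
   it. *)
pose C (p : R * R * R) : R * R * R := (Num.max 0 p.1.1, c p.1.2, c p.2).
have cC : continuous C.
  apply: continuous_pair; first apply: continuous_pair.
  - apply: continuous_maxr; first exact: cst_continuous.
    exact: (continuous_comp1 continuous_fst continuous_fst).
  - apply: (continuous_comp1 cc).
    exact: (continuous_comp1 continuous_snd continuous_fst).
  - exact: (continuous_comp1 cc continuous_snd).
have C_cyl p : cylinder (C p).
  by split => //=; split => //=; rewrite in_itv/= andbT le_max lexx.
exists (fun p => f (C p).1.1 (C p).1.2 (C p).2) => [p|t w m t0 wcl mcl].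
  (* Continuity within the cylinder is enough, since [C] takes all its values there. *)
  move/subspace_continuousP : cf => /(_ _ (C_cyl p)).
  apply: cvg_trans => A /= fA; have := cC p _ fA.
  by rewrite !nbhs_simpl /=; apply: filterS => q /(_ (C_cyl q)).
by rewrite /C /= !cE// (max_idPr _).
Qed.

(** * Parity of the kernel and cancellation of the normalised velocity *)

Lemma derive1_even {R : realType} (W : R -> R) (x : R) :
  (forall y, W (- y) = W y) -> derivable W (- x) 1 ->
  derive1 W (- x) = - derive1 W x.
Proof.
move=> We dW.
have dN : is_derive x 1 (W \o -%R) (derive1 W (- x) * -1).
  apply: is_derive1_comp; rewrite derive1E; exact: derivableP.
rewrite [in RHS](_ : W = W \o -%R); last by apply/funext => y /=; rewrite We.
by rewrite [in RHS]derive1E derive_val mulrN1 opprK.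
Qed.

(** Exchanging the two variables preserves [h] and changes the sign of the kernel, so by Fubini the
    integral equals its own opposite. *)
Lemma Rintegral_odd_kernel {R : realType} (h : R * R -> R) (D : R -> R)
    (a b : R) :
  continuous h -> continuous D ->
  {in `]a, b[ &, forall w m, h (w, m) = h (m, w)} ->
  (forall x, D (- x) = - D x) ->
  \int[@lebesgue_measure R]_(w in `]a, b[)
    \int[@lebesgue_measure R]_(m in `]a, b[) (h (w, m) * D (w - m)) = 0.
Proof.
move=> ch cD hs Do.
set J := LHS.
suff JN : J = - J by apply/eqP; rewrite -eqNr -JN.
pose k (p : R * R) := h p * D (p.1 - p.2).
have ck : continuous k.
  apply: continuous_mul => //.
  move=> p; apply: continuous_comp; last exact: cD.
  by apply: cvgB; [exact: cvg_fst|exact: cvg_snd].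
have ck2 w : continuous (fun m => k (w, m)).
  apply: continuous_comp2 => //; first exact: cst_continuous.
  by move=> m; exact: cvg_id.
rewrite {1}/J (Rintegral_itvoo_Fubini a b a b ck) -[in RHS]mulN1r /J.
rewrite -RintegralZl//; last first.
  apply: continuous_integrable_itvoo.
  exact: (@continuous_Rintegral_itvoo R R k a b ck).
apply: eq_Rintegral => w wab; rewrite -RintegralZl//; last first.
  exact: continuous_integrable_itvoo (ck2 w).
apply: eq_Rintegral => m mab.
rewrite inE in wab; rewrite inE in mab.
by rewrite /k /= hs// mulrCA mulN1r -Do opprB.
Qed.

(** The mass cancels the denominator of [eta], which removes the nonlinearity. If [h w] vanishes
    almost everywhere, [eta] is 0 by convention and the right-hand integrand is null almost
    everywhere, so both sides are 0. *)
Lemma velocity_mass {R : realType} (D : R -> R) (h : R -> R -> R) (w : R) :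
  (forall m, Omega m -> 0 <= h w m) ->
  (@lebesgue_measure R).-integrable Omega (EFin \o h w) ->
  (@lebesgue_measure R).-integrable Omega
    (EFin \o (fun m => h w m * D (w - m))) ->
  velocity D h w * \int[@lebesgue_measure R]_(m in Omega) h w m =
  \int[@lebesgue_measure R]_(m in Omega) (h w m * D (w - m)).
Proof.
move=> h0 ih ihD; have mO : measurable (@Omega R) by exact: measurable_itv.
rewrite /velocity /eta; case: asboolP => hae.
  under eq_Rintegral do rewrite mul0r.
  rewrite Rintegral_cst// !mul0r /Rintegral -[LHS]/(fine 0); congr fine.
  rewrite -(integral0 (@lebesgue_measure R) Omega).
  apply/esym/ae_eq_integral => //; first exact: measurable_int ihD.
  have := @ae_eq_comp2 _ _ R (@lebesgue_measure R) Omega R (\bar R)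
    (fun m y => (y * D (w - m))%:E) (h w) (cst 0) hae.
  by under [X in ae_eq _ _ _ X]eq_fun do rewrite mul0r.
pose H := \int[@lebesgue_measure R]_(m in Omega) h w m; rewrite -/H.
(* A nonnegative function with zero integral vanishes almost everywhere, the case already
   treated. *)
have H0 : H != 0.
  apply/eqP => H0; apply: hae.
  have : ae_eq (@lebesgue_measure R) Omega (EFin \o h w) (cst 0%E).
    apply/ae_eq_integral_abs => //; first exact: measurable_int ih.
    transitivity (\int[@lebesgue_measure R]_(m in Omega) (h w m)%:E)%E.
      by apply: eq_integral => m; rewrite inE => Om; rewrite /= ger0_norm// h0.
    by rewrite -(fineK (integrable_fin_num _ ih))// -/(Rintegral _ _ _) -/H H0.
  exact: (ae_eq_comp fine).
under eq_Rintegral do rewrite mulrAC.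
by rewrite RintegralZr// divfK.
Qed.

(** * First moment of the divergence and its integration in time *)

Lemma Rintegral_moment_divergence {R : realType} (f f' : R * R -> R) :
  continuous f -> continuous f' ->
  (forall w m, Omega w -> Omega m ->
    is_derive w 1 (fun x => f (x, m)) (f' (w, m))) ->
  (forall m, Omega m -> f (-1, m) = 0 /\ f (1, m) = 0) ->
  \int[@lebesgue_measure R]_(m in Omega) \int[@lebesgue_measure R]_(w in Omega)
    (w * (f' (w, m) + f' (m, w))) =
  - \int[@lebesgue_measure R]_(m in Omega)
      \int[@lebesgue_measure R]_(w in Omega) f (w, m).
Proof.
move=> cf cf' df f0; rewrite /Omega.
have cid : continuous (fun x : R => x) by move=> x; exact: cvg_id.
have ccst (x : R) : continuous (fun _ : R => x) by exact: cst_continuous.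
have lt11 : -1 < 1 :> R by rewrite gtrN.
have cfs : continuous (fun p : R * R => f (p.2, p.1)).
  exact: continuous_comp2 cf continuous_snd continuous_fst.
have cwf1 : continuous (fun p : R * R => p.2 * f' (p.2, p.1)).
  apply: continuous_mul continuous_snd _.
  exact: continuous_comp2 cf' continuous_snd continuous_fst.
have cwf2 : continuous (fun p : R * R => p.2 * f' p).
  exact: continuous_mul continuous_snd cf'.
(* Integration by parts: w * f' + f is the derivative of w * f, which vanishes at both endpoints. *)
have int1 m : Omega m -> \int[@lebesgue_measure R]_(w in `]-1, 1[)
    (w * f' (w, m)) = - \int[@lebesgue_measure R]_(w in `]-1, 1[) f (w, m).
  move=> Om; have cfm : continuous (fun w : R => f (w, m)).
    exact: continuous_comp2 cf cid (ccst m).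
  have cf'm : continuous (fun w : R => w * f' (w, m)).
    exact: (continuous_comp2 cwf1 (ccst m) cid).
  apply/eqP; rewrite -addr_eq0 -RintegralD//;
    [|exact: continuous_integrable_itvoo..].
  have [f1 f2] := f0 m Om.
  have cw : continuous (fun w : R => w * f (w, m)) by exact: continuous_mul.
  have cdw : continuous (fun w : R => w * f' (w, m) + f (w, m)).
    exact: continuous_add.
  have dw (w : R) : `]-1, 1[%classic w ->
      is_derive w 1 (fun x : R => x * f (x, m)) (w * f' (w, m) + f (w, m)).
    move=> Ow; have dfw := df w m Ow Om.
    apply: (is_derive_eq (is_deriveM (f := id) (g := fun x => f (x, m)) _ dfw)).
    by rewrite /GRing.scale /= mulr1.
  by rewrite (Rintegral_itvoo_FTC2 lt11 cdw cw dw) f1 f2 !mulr0 subrr.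
(* Here [f'] differentiates in [m] while the weight is [w]: integrating over [m] first takes the
   weight out and leaves only boundary values, which are zero. *)
have int2 : \int[@lebesgue_measure R]_(m in `]-1, 1[)
    \int[@lebesgue_measure R]_(w in `]-1, 1[) (w * f' (m, w)) = 0.
  rewrite (Rintegral_itvoo_Fubini _ _ _ _ cwf2) /=.
  transitivity (\int[@lebesgue_measure R]_(w in `]-1, 1[) (0 : R)); last first.
    by rewrite Rintegral_cst// mul0r.
  apply: eq_Rintegral => w; rewrite inE => Ow.
  have [f1 f2] := f0 w Ow.
  rewrite RintegralZl//; last first.
    apply: continuous_integrable_itvoo.
    exact: continuous_comp2 cf' cid (ccst w).
  have cfw : continuous (fun m : R => f (m, w)).
    exact: continuous_comp2 cf cid (ccst w).
  have cf'w : continuous (fun m : R => f' (m, w)).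
    exact: continuous_comp2 cf' cid (ccst w).
  have dfw m Om := df m w Om Ow.
  by rewrite (Rintegral_itvoo_FTC2 lt11 cf'w cfw dfw) f1 f2 subrr mulr0.
transitivity (\int[@lebesgue_measure R]_(m in `]-1, 1[)
    (\int[@lebesgue_measure R]_(w in `]-1, 1[) (w * f' (w, m)) +
     \int[@lebesgue_measure R]_(w in `]-1, 1[) (w * f' (m, w)))).
  apply: eq_Rintegral => m _; rewrite -RintegralD//.
  - by apply: eq_Rintegral => w _; rewrite mulrDr.
  - apply: continuous_integrable_itvoo.
    exact: (continuous_comp2 cwf1 (ccst m) cid).
  - apply: continuous_integrable_itvoo.
    exact: (continuous_comp2 cwf2 (ccst m) cid).
rewrite RintegralD//; last 2 first.
- apply: continuous_integrable_itvoo.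
  exact: (@continuous_Rintegral_itvoo R R _ (-1) 1 cwf1).
- apply: continuous_integrable_itvoo.
  exact: (@continuous_Rintegral_itvoo R R _ (-1) 1 cwf2).
rewrite int2 addr0 -[RHS]mulN1r -RintegralZl//; last first.
  apply: continuous_integrable_itvoo.
  exact: (@continuous_Rintegral_itvoo R R _ (-1) 1 cfs).
by apply: eq_Rintegral => m; rewrite inE => Om; rewrite int1// mulN1r.
Qed.

(** Differentiation under the integral is avoided: the increment of [f] is written as a time
    integral of -k, and Fubini moves that integral outside both space integrals. *)
Lemma moment_conserved {R : realType} (f k : R * R * R -> R) (t : R) :
  0 < t -> continuous f -> continuous k ->
  (forall s w m : R, 0 < s -> Omega w -> Omega m ->
    is_derive s 1 (fun r => f (r, w, m)) (- k (s, w, m))) ->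
  (forall s, 0 < s ->
    \int[@lebesgue_measure R]_(m in Omega)
      \int[@lebesgue_measure R]_(w in Omega) (w * k (s, w, m)) = 0) ->
  \int[@lebesgue_measure R]_(m in Omega)
    \int[@lebesgue_measure R]_(w in Omega) (w * f (t, w, m)) =
  \int[@lebesgue_measure R]_(m in Omega)
    \int[@lebesgue_measure R]_(w in Omega) (w * f (0, w, m)).
Proof.
move=> t0 cf ck df k0; rewrite /Omega.
have cid : continuous (fun x : R => x) by move=> x; exact: cvg_id.
have cst1 (x : R) : continuous (fun _ : R => x) by exact: cst_continuous.
have cst2 (x : R) : continuous (fun _ : R * R => x) by exact: cst_continuous.
have cwf s : continuous (fun p : R * R => p.2 * f (s, p.2, p.1)).
  apply: continuous_mul continuous_snd _.
  exact: continuous_comp3 cf (cst2 s) continuous_snd continuous_fst.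
have cwfm s m : continuous (fun w : R => w * f (s, w, m)).
  exact: continuous_comp2 (cwf s) (cst1 m) cid.
(* The variables are ordered as ((m, s), w), so that integrating out [w] leaves a continuous
   function of the pair (m, s). *)
have cwk : continuous (fun p : R * R * R => p.2 * k (p.1.2, p.2, p.1.1)).
  apply: continuous_mul continuous_snd _.
  apply: continuous_comp3 ck _ continuous_snd _.
    exact: continuous_comp1 continuous_snd continuous_fst.
  exact: continuous_comp1 continuous_fst continuous_fst.
have time_integral (w m : R) : Omega w -> Omega m ->
    \int[@lebesgue_measure R]_(s in `]0, t[) k (s, w, m) =
    f (0, w, m) - f (t, w, m).
  move=> Ow Om.
  have ckt : continuous (fun s : R => k (s, w, m)).
    exact: continuous_comp3 ck cid (cst1 w) (cst1 m).
  have cft : continuous (fun s : R => - f (s, w, m)).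
    by apply: continuous_opp; exact: continuous_comp3 cf cid (cst1 w) (cst1 m).
  have dft (s : R) : `]0, t[%classic s ->
      is_derive s 1 (fun r => - f (r, w, m)) (k (s, w, m)).
    rewrite /= in_itv /= => /andP[s0 _]; have dfs := df s w m s0 Ow Om.
    by apply: (is_derive_eq (is_deriveN (f := fun r => f (r, w, m)) dfs));
      rewrite opprK.
  by rewrite (Rintegral_itvoo_FTC2 t0 ckt cft dft) opprK addrC.
apply/esym/eqP; rewrite -subr_eq0 -RintegralB//; last 2 first.
- apply: continuous_integrable_itvoo.
  exact: (@continuous_Rintegral_itvoo R R _ (-1) 1 (cwf 0)).
- apply: continuous_integrable_itvoo.
  exact: (@continuous_Rintegral_itvoo R R _ (-1) 1 (cwf t)).
(* The left side is the moment at 0 minus the moment at [t], hence the positive sign of [k]. *)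
transitivity (\int[@lebesgue_measure R]_(m in `]-1, 1[)
    \int[@lebesgue_measure R]_(s in `]0, t[)
    \int[@lebesgue_measure R]_(w in `]-1, 1[) (w * k (s, w, m)) == 0).
  congr (_ == _); apply: eq_Rintegral => m; rewrite inE => Om.
  rewrite -RintegralB//; [|exact: continuous_integrable_itvoo..].
  have cwkm : continuous (fun p : R * R => p.2 * k (p.1, p.2, m)).
    exact: continuous_comp3 cwk (cst2 m) continuous_fst continuous_snd.
  rewrite (Rintegral_itvoo_Fubini 0 t (-1) 1 cwkm) /=.
  apply: eq_Rintegral => w; rewrite inE => Ow.
  rewrite RintegralZl ?time_integral ?mulrBr//.
  apply: continuous_integrable_itvoo.
  exact: continuous_comp3 ck cid (cst1 w) (cst1 m).
apply/eqP.
have cwwk : continuous (fun p : R * R =>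
    \int[@lebesgue_measure R]_(w in `]-1, 1[) (w * k (p.2, w, p.1))).
  exact: (@continuous_Rintegral_itvoo R (R * R)%type _ (-1) 1 cwk).
(* With time outermost, the inner double integral is the one that [k0] makes vanish. *)
rewrite (Rintegral_itvoo_Fubini (-1) 1 0 t cwwk) /=.
transitivity (\int[@lebesgue_measure R]_(s in `]0, t[) (0 : R)); last first.
  by rewrite Rintegral_cst// mul0r.
apply: eq_Rintegral => s; rewrite inE /= in_itv /= => /andP[s0 _].
exact: k0.
Qed.

(** * Conservation of the mean opinion for the edge density *)

Theorem lemma3p10 (R : realType) (W D : R -> R) (g : R -> R -> R -> R)
    (W_ge0 : forall x : R, 0 <= W x)
    (W_smooth : smooth W)
    (W_convex : strictly_convex W)
    (W_even : forall x : R, W (- x) = W x)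
    (W_min : forall x : R, x != 0 -> W 0 < W x)
    (D_def : forall x : R, D x = - derive1 W x)
    (g_ge0 : forall t w m : R, 0 <= t -> Omega w -> Omega m -> 0 <= g t w m)
    (g_sym : forall t w m : R, 0 <= t -> Omega w -> Omega m ->
      g t w m = g t m w)
    (g_reg : sufficiently_regular D g)
    (g_eq : solves_equation D g)
    (g_flux : zero_flux D g)
    (t : R) (t_ge0 : 0 <= t) :
  \int[@lebesgue_measure R]_(m in Omega)
    (\int[@lebesgue_measure R]_(w in Omega) (w * g t w m)) =
  \int[@lebesgue_measure R]_(m in Omega)
    (\int[@lebesgue_measure R]_(w in Omega) (w * g 0 w m)).
Proof.
have [[cg [gt _ dgt] _ _] cflux [Fw cFw dFw]] := g_reg.
(* [h], [f] and [f'] extend [g], the flux and its w-derivative separately; [f'] is shown to be the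
   derivative of [f] only for [w] and [m] in [Omega]. *)
have [h ch hE] := continuous_cyl_extension cg.
have [f cf fE] := continuous_cyl_extension cflux.
have [f' cf' f'E] := continuous_cyl_extension cFw.
have cid : continuous (fun x : R => x) by move=> x; exact: cvg_id.
have cst1 (x : R) : continuous (fun _ : R => x) by exact: cst_continuous.
have cst2 (x : R) : continuous (fun _ : R * R => x) by exact: cst_continuous.
have cD : continuous D.
  rewrite (_ : D = fun x => - derive1 W x); last exact/funext.
  apply: continuous_opp => x.
  exact/differentiable_continuous/derivable1_diffP/(W_smooth 1%N).
have Dodd x : D (- x) = - D x.
  by rewrite !D_def derive1_even//; exact: (W_smooth 0%N).
have Ocl (x : R) : Omega x -> clOmega x.
  exact: (subset_itvW _ _ (lexx _) (lexx _)).
have cl1 : clOmega (1 : R).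
  by rewrite /clOmega /= in_itv/= lexx andbT (le_trans (lerN10 _)).
have clN1 : clOmega (- 1 : R).
  by rewrite /clOmega /= in_itv/= lexx/= (le_trans (lerN10 _)).
have near_Omega (x : R) : Omega x -> \forall y \near x, Omega y.
  by move=> Ox; exact: near_in_itvoo.
have dflux (s w m : R) : 0 <= s -> Omega w -> Omega m ->
    is_derive w 1 (fun x => f (s, x, m)) (f' (s, w, m)).
  move=> s0 Ow Om; have dF := dFw s w m s0 Ow (Ocl _ Om).
  rewrite f'E//; [|exact: Ocl..]; apply: near_eq_is_derive dF.
  near=> x; rewrite fE//; [|exact: Ocl..].
  by apply: Ocl; near: x; exact: near_Omega.
have dh (s w m : R) : 0 < s -> Omega w -> Omega m ->
    is_derive s 1 (fun r => h (r, w, m)) (- (f' (s, w, m) + f' (s, m, w))).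
  move=> s0 Ow Om; have s0' := ltW s0.
  have dg := dgt s w m s0 (Ocl _ Ow) (Ocl _ Om).
  have dF1 := dFw s w m s0' Ow (Ocl _ Om).
  (* By symmetry of [g], the flux in [m] is the flux in the first variable with arguments exchanged,
     so [Fw] yields both divergence terms. *)
  have dF2 : is_derive m 1 (fun x => velocity D (g s) x * g s w x) (Fw s m w).
    apply: near_eq_is_derive (dFw s m w s0' Om (Ocl _ Ow)).
    near=> x; rewrite /flux g_sym//.
    by near: x; exact: near_Omega.
  have : is_derive s 1 (fun r => h (r, w, m)) (gt s w m).
    apply: near_eq_is_derive dg; near=> r.
    rewrite hE//; [|exact: Ocl..].
    by apply: ltW; near: r; exact: lt_nbhsr.
  move=> dhs; apply: is_derive_eq dhs _.
  have := g_eq s w m s0 Ow Om.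
  rewrite !derive1E (@derive_val _ _ _ _ _ _ _ dg)
    (@derive_val _ _ _ _ _ _ _ dF1) (@derive_val _ _ _ _ _ _ _ dF2) -addrA => /eqP.
  rewrite addr_eq0 => /eqP ->.
  by rewrite !f'E//; exact: Ocl.
have flux_mass (s w : R) : 0 <= s -> Omega w ->
    \int[@lebesgue_measure R]_(m in Omega) f (s, w, m) =
    \int[@lebesgue_measure R]_(m in Omega) (h (s, w, m) * D (w - m)).
  move=> s0 Ow.
  have hgE m : m \in Omega -> h (s, w, m) = g s w m.
    by rewrite inE => Om; rewrite hE//; exact: Ocl.
  have chw : continuous (fun m : R => h (s, w, m)).
    exact: continuous_comp3 ch (cst1 s) (cst1 w) cid.
  have chD : continuous (fun m : R => h (s, w, m) * D (w - m)).
    apply: continuous_mul => //; apply: (continuous_comp1 cD).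
    by apply: continuous_add => //; exact: continuous_opp.
  (* The velocity does not depend on [m] and comes out of the integral, which is then ready for
     [velocity_mass]. *)
  transitivity (velocity D (g s) w *
      \int[@lebesgue_measure R]_(m in Omega) h (s, w, m)).
    rewrite -RintegralZl//; last 2 first.
    - exact: measurable_itv.
    - exact: continuous_integrable_itvoo.
    apply: eq_Rintegral => m mO; rewrite hgE//.
    by rewrite inE in mO; rewrite fE//; exact: Ocl.
  under eq_Rintegral do rewrite hgE//.
  rewrite velocity_mass.
  - by apply: eq_Rintegral => m mO; rewrite hgE.
  - by move=> m Om; exact: g_ge0.
  - apply: (@eq_integrable _ _ R (@lebesgue_measure R) Omega
      (measurable_itv _) (EFin \o (fun m : R => h (s, w, m)))).
    + by move=> m mO; rewrite /= hgE.
    + exact: continuous_integrable_itvoo.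
  - apply: (@eq_integrable _ _ R (@lebesgue_measure R) Omega
      (measurable_itv _) (EFin \o (fun m : R => h (s, w, m) * D (w - m)))).
    + by move=> m mO; rewrite /= hgE.
    + exact: continuous_integrable_itvoo.
have flux_total (s : R) : 0 <= s ->
    \int[@lebesgue_measure R]_(m in Omega)
      \int[@lebesgue_measure R]_(w in Omega) f (s, w, m) = 0.
  move=> s0.
  have cfs : continuous (fun p : R * R => f (s, p.1, p.2)).
    exact: continuous_comp3 cf (cst2 s) continuous_fst continuous_snd.
  have chs : continuous (fun p : R * R => h (s, p.1, p.2)).
    exact: continuous_comp3 ch (cst2 s) continuous_fst continuous_snd.
  (* The order is exchanged because [flux_mass] integrates over [m] at fixed [w]. *)
  rewrite /Omega -(Rintegral_itvoo_Fubini (-1) 1 (-1) 1 cfs) /=.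
  apply: etrans (@Rintegral_odd_kernel R _ D (-1) 1 chs cD _ Dodd).
    by apply: eq_Rintegral => w; rewrite inE => Ow; exact: flux_mass.
  move=> w m Ow Om; rewrite /= !hE//; [|exact: Ocl..].
  exact: g_sym.
have moment_rate (s : R) : 0 < s ->
    \int[@lebesgue_measure R]_(m in Omega)
      \int[@lebesgue_measure R]_(w in Omega)
        (w * (f' (s, w, m) + f' (s, m, w))) = 0.
  move=> s0; have s0' := ltW s0.
  have cfs : continuous (fun p : R * R => f (s, p.1, p.2)).
    exact: continuous_comp3 cf (cst2 s) continuous_fst continuous_snd.
  have cf's : continuous (fun p : R * R => f' (s, p.1, p.2)).
    exact: continuous_comp3 cf' (cst2 s) continuous_fst continuous_snd.
  have dfs (w m : R) : Omega w -> Omega m ->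
      is_derive w 1 (fun x => f (s, x, m)) (f' (s, w, m)) by exact: dflux.
  (* The extension agrees with the flux on the closed cylinder, so it inherits the zero-flux
     boundary values. *)
  have bfs (m : R) : Omega m -> f (s, -1, m) = 0 /\ f (s, 1, m) = 0.
    move=> Om; rewrite !fE//; [|exact: Ocl..].
    have [f1 _] := g_flux s 1 m s0' (or_intror erefl) Om.
    by have [fN1 _] := g_flux s (-1) m s0' (or_introl erefl) Om.
  apply: etrans (Rintegral_moment_divergence cfs cf's dfs bfs) _.
  by rewrite flux_total// oppr0.
(* Time 0 is trivial and is set apart because the time integration needs a nondegenerate
   interval. *)
have [<-//|t_neq0] := eqVneq 0 t.
have t_gt0 : 0 < t by rewrite lt_neqAle t_neq0.
pose k (p : R * R * R) := f' p + f' (p.1.1, p.2, p.1.2).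
have ck : continuous k.
  apply: continuous_add => //; apply: continuous_comp3 cf' _ continuous_snd _.
    exact: continuous_comp1 continuous_fst continuous_fst.
  exact: continuous_comp1 continuous_snd continuous_fst.
have momentE (s : R) : 0 <= s ->
    \int[@lebesgue_measure R]_(m in Omega)
      \int[@lebesgue_measure R]_(w in Omega) (w * g s w m) =
    \int[@lebesgue_measure R]_(m in Omega)
      \int[@lebesgue_measure R]_(w in Omega) (w * h (s, w, m)).
  move=> s0; apply: eq_Rintegral => m; rewrite inE => Om.
  apply: eq_Rintegral => w; rewrite inE => Ow.
  by rewrite hE//; exact: Ocl.
rewrite !momentE//; exact: moment_conserved t_gt0 ch ck dh moment_rate.
Unshelve. all: by end_near.
Qed.
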